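(* Let $\mathfrak{G}$ be a finite group with $|\mathfrak{G}|\ge 2$ and put $p_c := 1-1/|\mathfrak{G}|$. For each $n\in\mathbb{N}$ let $K_n$ be the complete digraph on $n$ vertices, let $Q_n$ be the uniform observation kernel on $K_n$ with flip probability $p_n$, and let $\pi_n$ be the uniform distribution on $\mathfrak{G}$. Suppose that there exists $\beta>0$ such that $p_n\in[0,1]\setminus(p_c-\beta,p_c+\beta)$ for all $n\in\mathbb{N}$. Then the sequence of synchronization problems $\{(K_n,\mathfrak{G},Q_n,\pi_n)\}_{n=1}^{\infty}$ has the strong recovery property.
   Context: The complete digraph $K_n$ has vertex set $V_n=\{1,\dots,n\}$ and edge set $E_n=V_n\times V_n$. For a finite directed graph $G=(V,E)$ with $E\subset V\times V$ and a finite group $\mathfrak{G}$, define $\psi:\mathfrak{G}^V\to\mathfrak{G}^E$ by $\psi(x)(u,v)=x(u)^{-1}x(v)$ for $(u,v)\in E$ (written $\psi_n$ for the $n$-th graph of a sequence). An observation kernel $Q$ assigns to each $x\in\mathfrak{G}^V$ a probability distribution $Q(\cdot\mid\psi(x))$ on $\mathfrak{G}^E$. The uniform observation kernel with flip probability $p$ is $$Q(y\mid\psi(x))=\prod_{(u,v)\in E}Q'(y(u,v)\mid\psi(x)(u,v)),$$ where $Q'(y(u,v)\mid\psi(x)(u,v))=1-p$ if $y(u,v)=x(u)^{-1}x(v)$, and $=\frac{p}{|\mathfrak{G}|-1}$ otherwise. A synchronization problem is a tuple $(G,\mathfrak{G},Q,\pi)$, where $G=(V,E)$ is a graph, $\mathfrak{G}$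 a finite group, $Q$ an observation kernel and $\pi$ a probability distribution on $\mathfrak{G}$ (the prior). An estimator is a function $T:\mathfrak{G}^E\to\mathfrak{G}^E$. Given a sequence of synchronization problems $\{(G_n,\mathfrak{G},Q_n,\pi_n)\}$ with $G_n=(V_n,E_n)$, for each $n$ draw $X_n\in\mathfrak{G}^{V_n}$ from the product distribution $\pi_n^{V_n}$, then draw $Y_n\in\mathfrak{G}^{E_n}$ from $Q_n(\cdot\mid\psi_n(X_n))$, and set $\theta_n=\psi_n(X_n)$. A sequence of estimators $T_n:\mathfrak{G}^{E_n}\to\mathfrak{G}^{E_n}$ has the strong recovery property if $\lim_{n\to\infty}\mathbb{P}(T_n(Y_n)=\theta_n)=1$. The sequence of synchronization problems has the strong recovery property if there exists a sequence of estimators having the strong recovery property. *)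

(* Defs.v *)
From HB Require Import structures.
From mathcomp Require Import all_boot all_order all_algebra all_fingroup.
From mathcomp Require Import all_classical all_reals all_analysis.

Set Implicit Arguments.
Unset Strict Implicit.
Unset Printing Implicit Defensive.

Import Order.TTheory GRing.Theory Num.Theory numFieldNormedType.Exports.
Local Open Scope classical_set_scope.
Local Open Scope ring_scope.

Record fdist (R : realType) (A : finType) := FDist {
  fdist_fun :> A -> R;
  fdist_ge0 : forall a, 0 <= fdist_fun a;
  fdist_sum1 : \sum_(a : A) fdist_fun a = 1
}.

Definition Pr (R : realType) (A : finType) (P : fdist R A) (B : {set A}) : R :=
  \sum_(a in B) P a.

Section uniform_distribution.
Variables (R : realType) (gT : finGroupType).

Definition unif_fun (_ : gT) : R := (#|gT|%:R)^-1.

Lemma unif_ge0 g : 0 <= unif_fun g.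
Proof. by rewrite invr_ge0. Qed.

Lemma unif_sum1 : \sum_(g : gT) unif_fun g = 1.
Proof.
rewrite sumr_const /unif_fun -[LHS]mulr_natl mulfV // pnatr_eq0 -lt0n.
by rewrite -cardsT cardG_gt0.
Qed.

Definition fdist_unif := FDist unif_ge0 unif_sum1.
End uniform_distribution.

Section product_distribution.
Variables (R : realType) (V A : finType) (P : V -> fdist R A).

Definition pi_fun (x : {ffun V -> A}) : R := \prod_(v : V) P v (x v).

Lemma pi_ge0 x : 0 <= pi_fun x.
Proof. by apply: prodr_ge0 => v _; exact: fdist_ge0. Qed.

Lemma pi_sum1 : \sum_(x : {ffun V -> A}) pi_fun x = 1.
Proof.
rewrite /pi_fun -(bigA_distr_bigA (fun v a => P v a)).
by rewrite big1 // => v _; rewrite fdist_sum1.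
Qed.

Definition fdist_pi := FDist pi_ge0 pi_sum1.
End product_distribution.

(* Law of (X, Y) when X is drawn from P and then Y from W X. *)
Section joint_distribution.
Variables (R : realType) (A B : finType).
Variables (P : fdist R A) (W : A -> fdist R B).

Definition joint_fun (ab : A * B) : R := P ab.1 * W ab.1 ab.2.

Lemma joint_ge0 ab : 0 <= joint_fun ab.
Proof. by rewrite mulr_ge0 // fdist_ge0. Qed.

Lemma joint_sum1 : \sum_(ab : A * B) joint_fun ab = 1.
Proof.
rewrite -(pair_bigA _ (fun a b => joint_fun (a, b))) /joint_fun /=.
rewrite -[RHS](fdist_sum1 P); apply: eq_bigr => a _.
by rewrite -mulr_sumr fdist_sum1 mulr1.
Qed.

Definition fdist_joint := FDist joint_ge0 joint_sum1.
End joint_distribution.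

(* Loops are allowed, and (u, v) and (v, u) are different edges. *)
Record digraph := Digraph {
  vertex : finType;
  edges : {set vertex * vertex}
}.

Definition edge (G : digraph) : finType := {e : vertex G * vertex G | e \in edges G}.

Definition complete_digraph (n : nat) : digraph :=
  @Digraph 'I_n [set: 'I_n * 'I_n].

Definition vlabel (G : digraph) (gT : finGroupType) : finType :=
  {ffun vertex G -> gT}.

Definition elabel (G : digraph) (gT : finGroupType) : finType :=
  {ffun edge G -> gT}.

Definition psi (G : digraph) (gT : finGroupType) (x : vlabel G gT) :
    elabel G gT :=
  [ffun e : edge G => ((x (val e).1)^-1 * x (val e).2)%g].

(* The conditional law Q( . | theta) is given for every theta : elabel G gT;
   only its values at theta = psi x are ever used. *)
Definition kernel (R : realType) (G : digraph) (gT : finGroupType) :=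
  elabel G gT -> fdist R (elabel G gT).

Section uniform_kernel.
Variables (R : realType) (gT : finGroupType).
Hypothesis gT_gt1 : (1 < #|gT|)%N.
Variable p : {i01 R}.

Definition flip_fun (t y : gT) : R :=
  if y == t then 1 - p%:num else p%:num / (#|gT|%:R - 1).

Lemma flip_ge0 t y : 0 <= flip_fun t y.
Proof.
rewrite /flip_fun; case: ifP => _; first by rewrite subr_ge0.
by rewrite divr_ge0 // subr_ge0 ler1n ltnW.
Qed.

Lemma flip_sum1 t : \sum_(y : gT) flip_fun t y = 1.
Proof.
rewrite (bigD1 t) //= /flip_fun eqxx.
under eq_bigr => y /negbTE -> do [].
rewrite sumr_const cardC1 -[X in _ + X]mulr_natr -subn1 natrB ?(ltnW gT_gt1) //.
by rewrite divfK ?subrK // subr_eq0 pnatr_eq1 gtn_eqF.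
Qed.

Definition flip (t : gT) : fdist R gT := FDist (flip_ge0 t) (flip_sum1 t).

Definition uniform_kernel (G : digraph) : kernel R G gT :=
  fun theta => fdist_pi (fun e : edge G => flip (theta e)).
End uniform_kernel.

Record sync_problem (R : realType) (gT : finGroupType) := SyncProblem {
  graph : digraph;
  obs_kernel : kernel R graph gT;
  prior : fdist R gT
}.
Arguments obs_kernel {R gT} S : rename.

Definition estimator (R : realType) (gT : finGroupType)
    (S : sync_problem R gT) : Type :=
  elabel (graph S) gT -> elabel (graph S) gT.

Definition sync_law (R : realType) (gT : finGroupType)
    (S : sync_problem R gT) : fdist R (vlabel (graph S) gT * elabel (graph S) gT)%type :=
  fdist_joint (fdist_pi (fun _ : vertex (graph S) => prior S))
              (fun x => obs_kernel S (psi x)).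

Definition success_prob (R : realType) (gT : finGroupType)
    (S : sync_problem R gT) (T : estimator S) : R :=
  Pr (sync_law S) [set xy | T xy.2 == psi xy.1]%SET.

Definition estimators_strong_recovery (R : realType) (gT : finGroupType)
    (S : nat -> sync_problem R gT) (T : forall n, estimator (S n)) : Prop :=
  success_prob (T n) @[n --> \oo] --> (1 : R).

Definition strong_recovery (R : realType) (gT : finGroupType)
    (S : nat -> sync_problem R gT) : Prop :=
  exists T : forall n, estimator (S n), estimators_strong_recovery T.

Definition complete_sync_problem (R : realType) (gT : finGroupType)
    (gT_gt1 : (1 < #|gT|)%N) (p : {i01 R}) (n : nat) : sync_problem R gT :=
  SyncProblem (uniform_kernel gT_gt1 p (G := complete_digraph n))
              (fdist_unif R gT).

(* Main.v *)
(* For vertices u, v and each further vertex w, the relayed observation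
   y(u,w) y(w,v) equals theta(u,v) = x(u)^-1 x(v) with probability q, and every
   other group element with the same probability q'.  With b = p / (|G| - 1) and
   a = 1 - p one has q - q' = (a - b)^2 > 0 whichever side of p_c the flip
   probability lies on, so a plurality vote over w favours the truth.  The votes
   of distinct w use disjoint sets of edges, hence are independent, and an
   exponential-moment (Chernoff) bound makes each wrong outcome exponentially
   unlikely in n; a union bound over the n^2 |G| wrong outcomes concludes. *)
Require Import Defs.
From HB Require Import structures.
From mathcomp Require Import all_boot all_order all_algebra all_fingroup.
From mathcomp Require Import all_classical all_reals all_analysis.
From mathcomp Require Import ring lra.

Set Implicit Arguments.
Unset Strict Implicit.
Unset Printing Implicit Defensive.

Import Order.TTheory GRing.Theory Num.Theory numFieldNormedType.Exports.
Local Open Scope ring_scope.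

(** * Expectations under finite distributions *)

Section Mean.
Variable R : realType.

Definition mean (A : finType) (P : fdist R A) (f : A -> R) : R :=
  \sum_(a : A) P a * f a.

Lemma eq_mean (A : finType) (P : fdist R A) f g :
  f =1 g -> mean P f = mean P g.
Proof. by move=> fg; apply: eq_bigr => a _; rewrite fg. Qed.

Lemma mean_cst (A : finType) (P : fdist R A) c : mean P (fun=> c) = c.
Proof. by rewrite /mean -mulr_suml fdist_sum1 mul1r. Qed.

Lemma ler_mean (A : finType) (P : fdist R A) f g :
  (forall a, f a <= g a) -> mean P f <= mean P g.
Proof.
by move=> fg; apply: ler_sum => a _; rewrite ler_wpM2l ?fdist_ge0.
Qed.

Lemma mean_sum (A I : finType) (P : fdist R A) (Q : pred I) (F : I -> A -> R) :
  mean P (fun a => \sum_(i | Q i) F i a) = \sum_(i | Q i) mean P (F i).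
Proof.
by rewrite /mean exchange_big; apply: eq_bigr => a _; rewrite mulr_sumr.
Qed.

Lemma Pr_mean (A : finType) (P : fdist R A) (B : {set A}) :
  Pr P B = mean P (fun a => (a \in B)%:R).
Proof.
by rewrite /Pr /mean big_mkcond; apply: eq_bigr => a _; rewrite mulr_natr mulrb.
Qed.

Lemma Pr_setC (A : finType) (P : fdist R A) (B : {set A}) :
  Pr P B = 1 - Pr P (~: B).
Proof.
rewrite -(fdist_sum1 P) (bigID (mem B)) /= /Pr.
by under [X in _ - X]eq_bigl do rewrite inE; rewrite addrK.
Qed.

Lemma mean_joint (A B : finType) (P : fdist R A) (W : A -> fdist R B) f :
  mean (fdist_joint P W) f = mean P (fun a => mean (W a) (fun b => f (a, b))).
Proof.
rewrite /mean; under [RHS]eq_bigr do rewrite mulr_sumr.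
by rewrite pair_bigA; apply: eq_bigr => -[a b] _ /=; rewrite mulrA.
Qed.

End Mean.

(** * Independence of coordinates under product laws *)

Section Independence.
Variables (R : realType) (V A : finType) (P : V -> fdist R A).
Implicit Types (S : {set V}) (f g : {ffun V -> A} -> R).

Definition depends_on S f :=
  forall y z : {ffun V -> A}, {in S, y =1 z} -> f y = f z.

Definition splice S (yz : {ffun V -> A} * {ffun V -> A}) :=
  [ffun e => if e \in S then yz.1 e else yz.2 e].

Lemma mean_indep S f g : depends_on S f -> depends_on (~: S) g ->
  mean (fdist_pi P) (fun y => f y * g y) =
  mean (fdist_pi P) f * mean (fdist_pi P) g.
Proof.
move=> fS gS.
(* Swapping the coordinates outside [S] of two independent copies preserves
   their joint law and turns [f y * g z] into [f y * g y]. *)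
pose swap yz := (splice S yz, splice S (yz.2, yz.1)).
have swapK : involutive swap.
  move=> [y z]; rewrite /swap /=; congr pair; apply/ffunP => e;
  by rewrite !ffunE /= ?ffunE /=; case: (e \in S).
have -> : mean (fdist_pi P) (fun y => f y * g y) =
    \sum_(yz : {ffun V -> A} * {ffun V -> A})
       (fdist_pi P yz.1 * (f yz.1 * g yz.1)) * fdist_pi P yz.2.
  rewrite -(pair_bigA _ (fun y z => fdist_pi P y * (f y * g y) * fdist_pi P z)).
  by apply: eq_bigr => y _; rewrite -mulr_sumr pi_sum1 mulr1.
rewrite [RHS]mulr_suml; under [RHS]eq_bigr do rewrite mulr_sumr.
rewrite [RHS]pair_bigA /= (reindex_inj (inv_inj swapK)) /=.
apply: eq_bigr => -[y z] _ /=.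
have -> : f (splice S (y, z)) = f y.
  by apply: fS => e eS; rewrite ffunE eS.
have -> : g (splice S (y, z)) = g z.
  by apply: gS => e; rewrite inE ffunE; case: (e \in S).
suff Pswap : pi_fun P (splice S (y, z)) * pi_fun P (splice S (z, y)) =
    pi_fun P y * pi_fun P z.
  by rewrite mulrAC Pswap; ring.
rewrite /pi_fun -!big_split; apply: eq_bigr => e _ /=; rewrite !ffunE /=.
by case: ifP => // _; rewrite mulrC.
Qed.

Lemma mean_prod_indep (I : eqType) (r : seq I) (B : I -> {set V})
    (F : I -> {ffun V -> A} -> R) :
  uniq r -> {in r, forall i, depends_on (B i) (F i)} ->
  {in r &, forall i j, i != j -> [disjoint B i & B j]} ->
  mean (fdist_pi P) (fun y => \prod_(i <- r) F i y) =
  \prod_(i <- r) mean (fdist_pi P) (F i).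
Proof.
elim: r => [_ _ _|i r IH /= /andP[ir ur] dep dis].
  by rewrite big_nil -[RHS](mean_cst (fdist_pi P) 1);
    apply: eq_mean => y; rewrite big_nil.
rewrite big_cons -IH //; first last.
- by move=> j k jr kr; apply: dis; rewrite inE ?jr ?kr orbT.
- by move=> j jr; apply: dep; rewrite inE jr orbT.
rewrite -(@mean_indep (B i)).
- by apply: eq_mean => y; rewrite big_cons.
- by apply: dep; rewrite mem_head.
move=> y z yz; apply: eq_big_seq => j jr.
apply: (dep j); first by rewrite inE jr orbT.
move=> e ej; apply: yz; rewrite inE.
have ij : i != j by apply: contraNneq ir => ->.
have := dis i j (mem_head _ _) _ ij; rewrite inE jr orbT => /(_ isT).
by rewrite disjoint_sym => /disjointFr ->.
Qed.

Lemma mean_coord (e : V) (h : A -> R) :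
  mean (fdist_pi P) (fun y => h (y e)) = mean (P e) h.
Proof.
(* With [h] inserted at coordinate [e] only, the sum over functions factors into one sum per
   coordinate, and every factor other than that of [e] is a total mass 1. *)
pose G v a := P v a * (if v == e then h a else 1).
transitivity (\prod_v \sum_a G v a).
  rewrite bigA_distr_bigA; apply: eq_bigr => y _ /=.
  rewrite /pi_fun big_split /=; congr (_ * _).
  by rewrite -big_mkcond big_pred1_eq.
rewrite (bigD1 e) //= [X in _ * X]big1 ?mulr1 /G.
  by apply: eq_bigr => a _; rewrite eqxx.
by move=> v /negbTE ve; rewrite ve -[RHS](fdist_sum1 (P v));
  apply: eq_bigr => a _; rewrite mulr1.
Qed.

Lemma mean_coord2 (e1 e2 : V) (h : A -> A -> R) : e1 != e2 ->
  mean (fdist_pi P) (fun y => h (y e1) (y e2)) =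
  mean (P e1) (fun a => mean (P e2) (h a)).
Proof.
move=> e12.
(* Splitting over the value of [y e1] writes [h] as a sum of products, each factor of which sees a
   single coordinate. *)
transitivity (mean (fdist_pi P)
    (fun y => \sum_a (y e1 == a)%:R * h a (y e2))).
  apply: eq_mean => y; rewrite (bigD1 (y e1)) //= eqxx mul1r big1 ?addr0 // => a.
  by rewrite eq_sym => /negbTE ->; rewrite mul0r.
rewrite mean_sum.
transitivity (\sum_a mean (P e1) (fun b => (b == a)%:R) * mean (P e2) (h a)).
  apply: eq_bigr => a _; rewrite (@mean_indep [set e1]).
  - by rewrite (mean_coord e1 (fun b => (b == a)%:R)) (mean_coord e2).
  - by move=> y z yz; rewrite yz ?set11.
  - by move=> y z yz; rewrite yz // !inE eq_sym.
apply: eq_bigr => a _; congr (_ * _).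
rewrite /mean (bigD1 a) //= eqxx mulr1 big1 ?addr0 // => b /negbTE ->.
by rewrite mulr0.
Qed.

End Independence.

(** * The noise law and the exponential moment of one vote *)

Section Flip.
Variables (R : realType) (gT : finGroupType) (gT_gt1 : (1 < #|gT|)%N).
Variable p : {i01 R}.

Definition flip_base : R := p%:num / (#|gT|%:R - 1).

(** The law [flip t] is [flip_base] times counting measure plus [flip_bias] times the point mass at
    [t]; the bias is negative for flip probabilities above the threshold. *)
Definition flip_bias : R := 1 - p%:num - flip_base.

Lemma flip_base_bias : #|gT|%:R * flip_base + flip_bias = 1.
Proof.
rewrite /flip_bias /flip_base; field.
by rewrite subr_eq0 pnatr_eq1 gtn_eqF.
Qed.

Lemma mean_flip t f :
  mean (flip gT_gt1 p t) f = flip_base * (\sum_h f h) + flip_bias * f t.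
Proof.
rewrite /mean (bigD1 t) //= /flip_fun eqxx [\sum_h f h](bigD1 t) //=.
rewrite (eq_bigr (fun y => flip_base * f y)) => [|y /negbTE ->] //.
by rewrite -mulr_sumr /flip_bias; ring.
Qed.

(** Counting measure is invariant under translations, so convolving two noise laws multiplies their
    biases; the resulting square is what removes the sign. *)
Lemma mean_flip_mul t1 t2 (f : gT -> R) :
  mean (flip gT_gt1 p t1)
    (fun c => mean (flip gT_gt1 p t2) (fun d => f (c * d)%g)) =
  flip_base * (1 + flip_bias) * (\sum_h f h) + flip_bias ^+ 2 * f (t1 * t2)%g.
Proof.
have sumL c : \sum_d f (c * d)%g = \sum_h f h.
  by rewrite [RHS](reindex_inj (mulgI c)).
have sumC (c : R) : \sum_(h : gT) c = #|gT|%:R * c.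
  by rewrite sumr_const mulr_natl.
rewrite mean_flip; under eq_bigr do rewrite mean_flip sumL.
rewrite mean_flip sumL big_split /= -!mulr_sumr sumC.
have -> : \sum_c f (c * t2)%g = \sum_h f h.
  by rewrite [RHS](reindex_inj (mulIg t2)).
have -> : 1 + flip_bias = #|gT|%:R * flip_base + flip_bias *+ 2.
  by rewrite -[X in X + _ = _]flip_base_bias; ring.
ring.
Qed.

(* Multiplied over the votes [h], this gives [s ^ (votes for g - votes for t)]. *)
Definition tilt (s : R) (g t h : gT) : R := s ^+ (h == g) / s ^+ (h == t).

(** The values are [s] at [g], [1 / s] at [t] and 1 elsewhere, and
    [s + 1 / s - 2 = (s - 1) ^+ 2 / s]. *)
Lemma sum_tilt s g t : s != 0 -> g != t ->
  \sum_h tilt s g t h = #|gT|%:R + (s - 1) ^+ 2 / s.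
Proof.
move=> s0 gt; rewrite (bigD1 g) //= (bigD1 t) 1?eq_sym //=.
rewrite /tilt !eqxx (negbTE gt) eq_sym (negbTE gt) expr0 expr1.
rewrite (eq_bigr (fun=> 1)) => [|h /andP[/negbTE -> /negbTE ->]]; last first.
  by rewrite divr1.
rewrite sumr_const.
have -> : #|[pred i | i != g & i != t]|%:R = #|gT|%:R - 2 :> R.
  have := cardC (pred2 g t); rewrite card2 gt => /(congr1 (fun n => n%:R : R)).
  rewrite natrD => <-; rewrite addrAC subrr add0r; congr (_%:R).
  by apply: eq_card => h; rewrite !inE negb_or.
by field.
Qed.

(** At [s = 1 + D] the gain from the bias is of first order in [D] and the cost of tilting of second
    order. The moment is [1 - D / (1 + D) * (d ^+ 2 - q * D)], and both factors of the product are
    at least [D / 2]. *)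
Lemma mean_tilt_le (D : R) t1 t2 g : 0 < D <= 1 -> D <= flip_bias ^+ 2 ->
  g != (t1 * t2)%g ->
  mean (flip gT_gt1 p t1) (fun c => mean (flip gT_gt1 p t2)
    (fun d => tilt (1 + D) g (t1 * t2)%g (c * d)%g)) <= 1 - D ^+ 2 / 4.
Proof.
move=> /andP[D0 D1] Db gt.
have s0 : 1 + D != 0 by apply: lt0r_neq0; lra.
rewrite mean_flip_mul sum_tilt // /tilt eqxx eq_sym (negbTE gt) expr0 expr1.
have := flip_base_bias; set b := flip_base; set d := flip_bias in Db *.
(* Here [q] is the probability that the relay takes a given wrong value; total mass 1 gives [kq],
   whence [q <= 1 / 2]. *)
set q := b * (1 + d) => bd.
have kq : #|gT|%:R * q = 1 - d ^+ 2.
  have dE : d = 1 - #|gT|%:R * b by lra.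
  by rewrite /q dE; ring.
have q2 : q <= 1 / 2.
  have k2 : 2 <= #|gT|%:R :> R by rewrite ler_nat.
  have := sqr_ge0 d; have [|q0] := lerP q 0; first lra.
  have : 2 * q <= #|gT|%:R * q by rewrite ler_pM2r.
  lra.
have -> : q * (#|gT|%:R + (1 + D - 1) ^+ 2 / (1 + D)) + d ^+ 2 * (1 / (1 + D)) =
    1 - D / (1 + D) * (d ^+ 2 - q * D).
  by rewrite mulrDr [q * #|_|%:R]mulrC kq; field.
have h1 : D / 2 <= D / (1 + D).
  by rewrite ler_pM2l // lef_pV2 ?posrE; lra.
have h2 : D / 2 <= d ^+ 2 - q * D.
  have : q * D <= 1 / 2 * D by rewrite ler_pM2r.
  lra.
have : D / 2 * (D / 2) <= D / (1 + D) * (d ^+ 2 - q * D).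
  by apply: ler_pM => //; lra.
rewrite expr2; lra.
Qed.

End Flip.

(** * Plurality voting over relays, and its failure probability *)

Section Voting.
Variables (R : realType) (gT : finGroupType) (gT_gt1 : (1 < #|gT|)%N) (n : nat).
Local Notation K := (complete_digraph n).
Implicit Types (u v w : 'I_n) (y : elabel K gT) (x : vlabel K gT).

Definition mk_edge u v : edge K := exist _ (u, v) (finset.in_setT (u, v)).

Lemma mk_edge_eq u v u' v' :
  (mk_edge u v == mk_edge u' v') = (u == u') && (v == v').
Proof. by []. Qed.

(* Leaving out [u] and [v] makes the two-edge paths from [u] to [v] pairwise
   edge-disjoint, also when [u = v]. *)
Definition relays u v : {set 'I_n} := [set w | (w != u) && (w != v)].

Definition relay y u v w : gT := (y (mk_edge u w) * y (mk_edge w v))%g.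

Definition votes y u v g : nat := \sum_(w in relays u v) (relay y u v w == g).

Definition plurality : elabel K gT -> elabel K gT := fun y =>
  [ffun e => [arg max_(g > 1%g) votes y (val e).1 (val e).2 g]%N].

Lemma card_relays u v : (n - 2 <= #|relays u v|)%N.
Proof.
have := cardsC [set u; v]; rewrite card_ord cards2.
have -> : ~: [set u; v] = relays u v.
  by apply/setP => w; rewrite !inE negb_or.
by move=> nE; rewrite leq_subLR -[X in (X <= _)%N]nE leq_add2r; case: (u != v).
Qed.

Lemma mean_votes_le (p : {i01 R}) (D : R) (x : vlabel K gT) u v g :
  0 < D <= 1 -> D <= flip_bias gT p ^+ 2 -> g != ((x u)^-1 * x v)%g ->
  mean (uniform_kernel gT_gt1 p (psi x))
    (fun y => (votes y u v ((x u)^-1 * x v)%g <= votes y u v g)%N%:R)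
  <= (1 - D ^+ 2 / 4) ^+ #|relays u v|.
Proof.
move=> D01 Db gt; set t := ((x u)^-1 * x v)%g in gt *.
have s1 : 1 < 1 + D by case/andP: D01; lra.
have s0 : 0 < 1 + D by lra.
pose F w y := tilt (1 + D) g t (relay y u v w).
(* Chernoff: the product is [1 + D] raised to the vote lead of [g] over [t], hence at least 1
   whenever [t] does not win strictly. *)
apply: (@le_trans _ _ (mean (uniform_kernel gT_gt1 p (psi x))
    (fun y => \prod_(w <- enum (relays u v)) F w y))).
  apply: ler_mean => y; rewrite big_enum /= big_split /= prodrXr prodfV prodrXr.
  rewrite -/(votes y u v g) -/(votes y u v t).
  case: leqP => [tg|_]; last by rewrite divr_ge0 // exprn_ge0 // ltW.
  by rewrite ler_pdivlMr ?exprn_gt0 // mul1r ler_weXn2l // ltW.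
rewrite (@mean_prod_indep _ _ _ _ _ _
    (fun w => [set mk_edge u w; mk_edge w v])) ?enum_uniq //; first last.
- move=> w w'; rewrite !mem_enum !inE => /andP[wu wv] /andP[wu' wv'] ww'.
  apply/pred0P => e; rewrite !inE /=; apply/negbTE.
  apply/negP => /andP[/orP[]/eqP-> ]; rewrite !mk_edge_eq.
    by rewrite (negbTE ww') andbF /= eq_sym (negbTE wu').
  by rewrite (negbTE wu) (negbTE ww').
- move=> w _ y z yz; rewrite /F /relay !yz ?inE ?eqxx ?orbT //.
rewrite big_enum /= -prodr_const; apply: ler_prod => w.
rewrite inE => /andP[wu wv].
apply/andP; split.
  apply: sumr_ge0 => y _; rewrite mulr_ge0 ?fdist_ge0 //.
  by rewrite divr_ge0 // exprn_ge0 // ltW.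
rewrite /F /relay (mean_coord2 _ (fun a b => tilt (1 + D) g t (a * b)%g)).
  rewrite !ffunE /=.
  have tE : t = (((x u)^-1 * x w) * ((x w)^-1 * x v))%g.
    by rewrite mulgA mulgK.
  by rewrite tE; apply: mean_tilt_le; rewrite -?tE.
by rewrite mk_edge_eq eq_sym (negbTE wu).
Qed.

(** A wrong maximiser has at least as many votes as the truth; the inequality is not strict because
    a tie may be broken either way. *)
Lemma plurality_failure y x : plurality y != psi x ->
  exists u v g, g != ((x u)^-1 * x v)%g /\
    (votes y u v ((x u)^-1 * x v)%g <= votes y u v g)%N.
Proof.
apply: contra_neqP => H; apply/ffunP => e; rewrite !ffunE.
case: arg_maxnP => // g _ gmax; apply/eqP; apply: contrapT => /negP ge.
apply: H; exists (val e).1, (val e).2, g; split => //; exact: gmax.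
Qed.

Lemma mean_failure_le (p : {i01 R}) (D : R) (x : vlabel K gT) :
  0 < D <= 1 -> D <= flip_bias gT p ^+ 2 ->
  mean (uniform_kernel gT_gt1 p (psi x)) (fun y => (plurality y != psi x)%:R)
  <= (n * n * #|gT|)%:R * (1 - D ^+ 2 / 4) ^+ (n - 2).
Proof.
move=> D01 Db.
have r01 : 0 <= 1 - D ^+ 2 / 4 <= 1.
  by case/andP: D01 => D0 D1; apply/andP; split; nra.
pose t u v := ((x u)^-1 * x v)%g.
pose I := ('I_n * 'I_n * gT)%type.
pose F (i : I) y : R :=
  (votes y i.1.1 i.1.2 (t i.1.1 i.1.2) <= votes y i.1.1 i.1.2 i.2)%N%:R.
pose Q (i : I) := i.2 != t i.1.1 i.1.2.
(* Union bound over the triples [(u, v, g)] with [g] wrong, for a fixed labelling [x]. *)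
apply: (@le_trans _ _ (mean (uniform_kernel gT_gt1 p (psi x))
    (fun y => \sum_(i | Q i) F i y))).
  apply: ler_mean => y; case: (boolP (plurality y != psi x)); last first.
    by move=> _; apply: sumr_ge0 => i _; exact: ler0n.
  move=> /plurality_failure[u [v [g [gt gvotes]]]].
  rewrite (bigD1 (u, v, g)) //= {1}/F /= gvotes lerDl.
  by apply: sumr_ge0 => i _; exact: ler0n.
rewrite mean_sum.
apply: (@le_trans _ _ (\sum_(i : I) (1 - D ^+ 2 / 4) ^+ (n - 2))).
  rewrite big_mkcond /=; apply: ler_sum => -[[u v] g] _; case: ifP => [gt|_].
    apply: le_trans (mean_votes_le D01 Db gt) _.
    by case/andP: r01 => r0 r1; apply: ler_wiXn2l => //; exact: card_relays.
  by rewrite exprn_ge0 //; case/andP: r01.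
have cI : #|{: I}| = (n * n * #|gT|)%N by rewrite !card_prod !card_ord.
by rewrite -cI mulr_natl -sumr_const.
Qed.

End Voting.

(** * Geometric decay beats a quadratic factor *)

Section Decay.
Variable R : realType.

Lemma bernoulli_le (h : R) j : 0 <= h -> 1 + j%:R * h <= (1 + h) ^+ j.
Proof.
move=> h0; elim: j => [|j IH]; first by rewrite mul0r addr0 expr0.
have j0 : 0 <= j%:R :> R by exact: ler0n.
rewrite exprS -natr1; nra.
Qed.

Lemma poly_geom_decay (c e : R) : 0 <= c -> 0 < e <= 1 ->
  exists2 M : R, 0 <= M &
    forall j : nat, (j.+2 ^ 2)%:R * c * (1 - e) ^+ j <= M * harmonic j.
Proof.
(* The choice [h = e / 3] makes [(1 - e) * (1 + h) ^+ 3 <= 1]. Bernoulli then gives three factors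
   [j.+1]: two absorb the quadratic term, the third leaves [harmonic j]. *)
move=> c0 /andP[e0 e1]; pose h : R := e / 3.
have h0 : 0 < h by rewrite /h; lra.
have h1 : h <= 1 by rewrite /h; lra.
exists (4 * c / h ^+ 3) => [|j].
  by rewrite divr_ge0 ?exprn_ge0 ?mulr_ge0 // ltW.
have cube : (1 - e) * (1 + h) ^+ 3 <= 1.
  have -> : e = 3 * h by rewrite /h; field.
  have := sqr_ge0 h; have := exprn_ge0 3 (ltW h0); have := exprn_ge0 4 (ltW h0).
  move=> ? ? ?; lra.
have J0 : 0 < j.+1%:R :> R by rewrite ltr0n.
have base : j.+1%:R * h <= (1 + h) ^+ j.
  by apply: le_trans (bernoulli_le j (ltW h0)); rewrite -natr1; lra.
have decay : (1 - e) ^+ j * (j.+1%:R * h) ^+ 3 <= 1.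
  apply: (@le_trans _ _ ((1 - e) ^+ j * ((1 + h) ^+ j) ^+ 3)).
    apply: ler_wpM2l; first by rewrite exprn_ge0 //; lra.
    by rewrite lerXn2r // nnegrE ?exprn_ge0 ?mulr_ge0 //; lra.
  rewrite -exprM mulnC exprM -exprMn exprn_ile1 // mulr_ge0 ?exprn_ge0 //; lra.
(* From [j + 2 <= 2 * (j + 1)]; this is the 4 in the witness. *)
have j2 : (j.+2 ^ 2)%:R <= 4 * j.+1%:R ^+ 2 :> R.
  by rewrite -natrX -natrM ler_nat -[4%N]/(2 ^ 2)%N -expnMn leq_exp2r //
    mul2n doubleS !ltnS -addnn leq_addr.
apply: (@le_trans _ _ (4 * j.+1%:R ^+ 2 * c * (1 - e) ^+ j)).
  by rewrite !ler_wpM2r // exprn_ge0 //; lra.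
rewrite /harmonic /= -[X in X <= _]mulr1.
have -> : 4 * c / h ^+ 3 * j.+1%:R^-1 =
    4 * j.+1%:R ^+ 2 * c / (j.+1%:R * h) ^+ 3.
  by field; rewrite !lt0r_neq0.
rewrite mulr1; apply: ler_wpM2l; first by rewrite !mulr_ge0 ?sqr_ge0.
by rewrite -[leRHS]mul1r ler_pdivlMr ?exprn_gt0 ?mulr_gt0.
Qed.

End Decay.

(** * Distance from the threshold, and strong recovery *)

(** The bias equals [(pc - p) / pc] for the threshold [pc = 1 - 1 / #|gT|], and dividing by
    [pc <= 1] cannot shrink the distance [beta]. *)
Lemma flip_bias_ge (R : realType) (gT : finGroupType) (p : {i01 R}) (beta : R) :
  (1 < #|gT|)%N -> 0 < beta ->
  p%:num \notin `](1 - 1 / #|gT|%:R - beta), (1 - 1 / #|gT|%:R + beta)[ ->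
  beta ^+ 2 <= flip_bias gT p ^+ 2.
Proof.
move=> k1 b0; rewrite in_itv /= negb_and -!leNgt => pout.
have k2 : 1 < #|gT|%:R :> R by rewrite ltr1n.
set k : R := #|gT|%:R in k2 pout *.
have pc0 : 0 < 1 - 1 / k by rewrite subr_gt0 ltr_pdivrMr; lra.
have pc1 : 1 - 1 / k <= 1 by rewrite gerBl divr_ge0; lra.
have -> : flip_bias gT p = (1 - 1 / k - p%:num) / (1 - 1 / k).
  rewrite /flip_bias /flip_base -/k; field.
  by rewrite !lt0r_neq0; lra.
rewrite expr_div_n ler_pdivlMr ?exprn_gt0 //.
apply: (@le_trans _ _ (beta ^+ 2)).
  by rewrite ler_piMr ?exprn_ge0 ?exprn_ile1 // ltW.
case/orP: pout => ?; nra.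
Qed.

(* The sequence starts at n = 1: its term of rank m is the problem on K_(m+1)
   with flip probability p (m+1); p 0 is irrelevant. *)
Theorem theorem1 (R : realType) (gT : finGroupType) (gT_gt1 : (1 < #|gT|)%N)
    (p : nat -> {i01 R})
    (p_away : let pc : R := 1 - 1 / #|gT|%:R in
      exists beta : R, 0 < beta /\
        forall n : nat, (0 < n)%N ->
          (p n)%:num \notin `]pc - beta, pc + beta[) :
  strong_recovery
    (fun m : nat => complete_sync_problem gT_gt1 (p m.+1) m.+1).
Proof.
case: p_away => beta [b0 pout].
(* One tilt for all [n]: below every squared bias, and capped at 1 as the moment bound requires. *)
pose D := Num.min (beta ^+ 2) 1; pose e := D ^+ 2 / 4.
have D01 : 0 < D <= 1 by rewrite lt_min ge_min exprn_gt0 // ltr01 lexx orbT.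
have Db n : D <= flip_bias gT (p n.+1) ^+ 2.
  by rewrite ge_min flip_bias_ge // pout.
have e01 : 0 < e <= 1.
  by case/andP: D01 => D0 D1; apply/andP; rewrite /e; split; nra.
have [M M0 decay] := poly_geom_decay (ler0n R #|gT|) e01.
exists (fun m => @plurality gT m.+1); rewrite /estimators_strong_recovery.
have failure m (S := complete_sync_problem gT_gt1 (p m.+1) m.+1) :
    success_prob (S := S) (@plurality gT m.+1) =
    1 - mean (sync_law S) (fun xy => (plurality xy.2 != psi xy.1)%:R).
  rewrite /success_prob Pr_setC Pr_mean; congr (1 - _).
  by apply: eq_mean => xy; rewrite !inE.
(* Dropping the first term leaves [j + 2] vertices at rank [j], so that the exponent [n - 2] is
   exactly [j]. *)
rewrite -cvg_shiftS.
apply: (@squeeze_cvgr _ _ _ _ (fun j => 1 - M * harmonic j) (fun=> 1)); first last.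
- exact: cvg_cst.
- have : ((1 - M * harmonic j) @[j --> \oo] --> (1 - M * 0 : R))%classic.
    by apply: cvgB; [exact: cvg_cst|apply: cvgMr; exact: cvg_harmonic].
  by rewrite mulr0 subr0.
near=> j; rewrite /= failure gerBl; apply/andP; split; last first.
  by apply: sumr_ge0 => xy _; rewrite mulr_ge0 ?fdist_ge0 ?ler0n.
rewrite lerD2l lerN2 mean_joint; apply: le_trans (decay j).
(* The bound is uniform in [x], so it survives averaging over the prior. *)
rewrite -[leRHS](mean_cst (fdist_pi (fun _ : 'I_j.+2 => fdist_unif R gT))).
apply: ler_mean => x; apply: le_trans (mean_failure_le _ x D01 (Db _)) _.
by rewrite natrM -mulnn subn2.
Unshelve. all: by end_near.
Qed.
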